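(* Let $d\ge 1$ and let $\vec{w}=(w_1,\ldots,w_d)$ be a vector of positive integers. Then $ex2(\vec{w},I_{2,d})=\prod_{i=1}^d w_i-\prod_{i=1}^d (w_i-1)$. Moreover, every maximal $w_1\times\cdots\times w_d$ binary matrix that 2-avoids $I_{2,d}$ has exactly $\prod_{i=1}^d w_i-\prod_{i=1}^d (w_i-1)$ one entries.
   Context: A $w_1\times\cdots\times w_d$ binary matrix $M$ assigns to each integer vector $\vec{x}=(x_1,\ldots,x_d)$ with $1\le x_i\le w_i$ for all $i$ a value $M_{\vec{x}}\in\{0,1\}$; entries with value 1 are one entries. $I_{2,d}$ denotes the $2\times\cdots\times 2$ $d$-dimensional identity matrix (one entries exactly at $(1,\ldots,1)$ and $(2,\ldots,2)$). For $d\ge 2$, $M$ 2-contains $I_{2,d}$ if it contains $I_{2,d}$ in the usual sense, i.e. there are one entries $\vec{x},\vec{y}$ of $M$ with $x_i<y_i$ for every $i\in[1,d]$; for $d=1$, $M$ 2-contains $I_{2,1}$ if it has more than one one entry. $M$ 2-avoids $I_{2,d}$ if it does not 2-contain it. $ex2(\vec{w},I_{2,d})$ is the maximum number of one entries of a $w_1\times\cdots\times w_d$ binary matrix that 2-avoids $I_{2,d}$. A matrix that 2-avoids $I_{2,d}$ is maximal if changing any of its zero entries to one makes it 2-contain $I_{2,d}$. (Equivalently: on the set of integer vectors with $1\le x_i\le w_i$, ordered by $\vec{y}<\vec{x}$ iff $y_i<x_i$ for all $i$, every maximal antichain is maximum and has size $\prod w_i-\prod(w_i-1)$.) *)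

(* Defs.v *)
From mathcomp Require Import all_boot.

Set Implicit Arguments.
Unset Strict Implicit.
Unset Printing Implicit Defensive.

(* Coordinates are numbered from 0: the i-th one ranges over
   {0, ..., w i - 1} instead of {1, ..., w i}. *)
Definition position (d : nat) (w : 'I_d -> nat) : Type :=
  {dffun forall i : 'I_d, 'I_(w i)}.

Definition pos_of (d : nat) (w : 'I_d -> nat) (f : forall i, 'I_(w i)) :
  position w := [ffun i : 'I_d => f i].

Definition binmx (d : nat) (w : 'I_d -> nat) : Type :=
  {ffun position w -> bool}.

Definition one_entries (d : nat) (w : 'I_d -> nat) (M : binmx w) :
  {set position w} := [set x | M x].

(* Usual containment of a pattern P: [f i] lists, in increasing order, the
   coordinates kept in direction i; the resulting submatrix of M must have a
   one wherever P has one. *)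
Definition contains (d : nat) (w p : 'I_d -> nat) (M : binmx w)
    (P : binmx p) : bool :=
  [exists f : {dffun forall i : 'I_d, {ffun 'I_(p i) -> 'I_(w i)}},
    [forall i : 'I_d, forall a : 'I_(p i), forall b : 'I_(p i),
       (a < b) ==> (f i a < f i b)]
    && [forall x : position p, P x ==> M (pos_of (fun i => f i (x i)))]].

Definition id2mx (d : nat) : binmx (fun _ : 'I_d => 2) :=
  [ffun x : position (fun _ : 'I_d => 2) =>
     [forall i : 'I_d, x i == ord0] || [forall i : 'I_d, x i == ord_max]].

Definition contains2_id (d : nat) (w : 'I_d -> nat) (M : binmx w) : bool :=
  if d == 1 then 1 < #|one_entries M| else contains M (id2mx d).

Definition avoids2_id (d : nat) (w : 'I_d -> nat) (M : binmx w) : bool :=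
  ~~ contains2_id M.

(* The zero matrix avoids the pattern, so the maximum is over a nonempty
   family. *)
Definition ex2_id (d : nat) (w : 'I_d -> nat) : nat :=
  \max_(M : binmx w | avoids2_id M) #|one_entries M|.

Definition set_one (d : nat) (w : 'I_d -> nat) (M : binmx w)
    (x : position w) : binmx w :=
  [ffun y => (y == x) || M y].

Definition maximal_avoids2_id (d : nat) (w : 'I_d -> nat) (M : binmx w) :
    Prop :=
  avoids2_id M /\
  forall x : position w, M x = false -> contains2_id (set_one M x).

Lemma contains_id2mxP (d : nat) (w : 'I_d -> nat) (M : binmx w) :
  reflect (exists x y : position w,
             [/\ M x, M y & forall i : 'I_d, x i < y i])
          (contains M (id2mx d)).
Proof.
apply: (iffP existsP) => [[f /andP[/forallP inc /forallP sub]]|[x [y [Mx My xy]]]].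
  exists (pos_of (fun i => f i ord0)), (pos_of (fun i => f i ord_max)); split.
  - have /implyP := sub (pos_of (fun=> ord0)).
    have -> : id2mx d (pos_of (fun=> ord0)).
      by rewrite ffunE; apply/orP; left; apply/forallP => i; rewrite ffunE.
    move=> /(_ isT); congr (is_true (M _)).
    by apply/ffunP => i; rewrite !ffunE.
  - have /implyP := sub (pos_of (fun=> ord_max)).
    have -> : id2mx d (pos_of (fun=> ord_max)).
      by rewrite ffunE; apply/orP; right; apply/forallP => i; rewrite ffunE.
    move=> /(_ isT); congr (is_true (M _)).
    by apply/ffunP => i; rewrite !ffunE.
  - move=> i; rewrite !ffunE.
    by have /forallP/(_ ord0)/forallP/(_ ord_max)/implyP := inc i; apply.
exists [ffun i : 'I_d => [ffun a : 'I_2 => if a == ord0 then x i else y i]].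
apply/andP; split.
  apply/forallP => i; apply/forallP => a; apply/forallP => b; apply/implyP => ab.
  rewrite !ffunE; case: a b ab => [[|[|//]] ?] [[|[|//]] ?] //= _; exact: xy.
apply/forallP => z; apply/implyP; rewrite ffunE => /orP[] /forallP zE.
  suff -> : pos_of (fun i => [ffun i => [ffun a : 'I_2 =>
     if a == ord0 then x i else y i]] i (z i)) = x by [].
  by apply/ffunP => i; rewrite !ffunE (eqP (zE i)).
suff -> : pos_of (fun i => [ffun i => [ffun a : 'I_2 =>
     if a == ord0 then x i else y i]] i (z i)) = y by [].
by apply/ffunP => i; rewrite !ffunE (eqP (zE i)).
Qed.

(* Main.v *)
(* The order "x < y iff x i < y i for all i" splits the box into diagonals, the
   chains z, z + (1, ..., 1), z + (2, ..., 2), ... issuing from the positions z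
   with a zero coordinate. There are \prod w i - \prod (w i - 1) of them, and an
   antichain meets each one at most once; the set of their starting points is
   an antichain that meets them all.
   A maximal antichain A also meets every diagonal. If A misses the one of z,
   then by induction on t, z + t lies in the box and is above no element of A,
   which is absurd for large t: being outside A, z + t is comparable to, hence
   below, some a in A, so z + (t + 1) <= a lies in the box, and
   a' < z + (t + 1) with a' in A would give a' <= z + t < a. *)
Require Import Defs.
From mathcomp Require Import all_boot.

Set Implicit Arguments.
Unset Strict Implicit.
Unset Printing Implicit Defensive.

(** For [d = 1] two distinct ones are always comparable, because their single coordinates are; so
    both clauses of the definition reduce to the existence of a comparable pair. *)
Lemma contains2_idP (d : nat) (w : 'I_d -> nat) (M : binmx w) : 0 < d ->
  reflect (exists x y : position w, [/\ M x, M y & forall i, x i < y i])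
          (contains2_id M).
Proof.
rewrite /contains2_id; case: eqP => [d1 _|_ _]; last exact: contains_id2mxP.
subst d; apply: (iffP card_gt1P) => [[x [y]]|[x [y [Mx My xy]]]].
  rewrite !inE => -[Mx My xy].
  have [lt_xy|lt_yx|eq_xy] := ltngtP (x ord0) (y ord0).
  - by exists x, y; split=> // i; rewrite (ord1 i).
  - by exists y, x; split=> // i; rewrite (ord1 i).
  case/eqP: xy; apply/ffunP => i; apply: val_inj.
  by rewrite (ord1 i).
exists x, y; rewrite !inE; split=> //.
by apply: contraTneq (xy ord0) => ->; rewrite ltnn.
Qed.

Definition starts (d : nat) (w : 'I_d -> nat) : {set position w} :=
  [set x : position w | [exists i, x i == 0 :> nat]].

Lemma card_nonzero_ord (n : nat) : #|[pred k : 'I_n | k != 0 :> nat]| = n - 1.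
Proof.
case: n => [|n]; first by apply: eq_card0 => -[].
by rewrite subn1 (eq_card (B := predC1 ord0)) ?cardC1 ?card_ord.
Qed.

Lemma card_starts (d : nat) (w : 'I_d -> nat) :
  #|starts w| = \prod_(i < d) w i - \prod_(i < d) (w i - 1).
Proof.
rewrite cardsCs card_dep_ffun foldrE big_image.
under eq_bigr do rewrite card_ord; congr (_ - _).
pose nonzero (i : 'I_d) : pred 'I_(w i) :=
  [pred k : 'I_(w i) | k != 0 :> nat].
(* The complement of [starts] is itself a box, with [w i - 1] choices in direction [i]. *)
transitivity #|(family nonzero : pred (position w))|.
  by apply: eq_card => x; rewrite !inE negb_exists.
rewrite card_family foldrE big_image.
by apply: eq_bigr => i _; apply: card_nonzero_ord.
Qed.

Lemma starts_avoid (d : nat) (w : 'I_d -> nat) : 0 < d ->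
  avoids2_id ([ffun x => x \in starts w] : binmx w).
Proof.
move=> d_gt0; apply/negP => /contains2_idP-/(_ d_gt0) [x [y []]] _.
by rewrite ffunE inE => /existsP[i /eqP y0] /(_ i); rewrite y0.
Qed.

(** The number of diagonal steps from the start of the diagonal of [x] to [x]; [i0] is the default
    index that [arg min] requires. *)
Definition depth (d : nat) (w : 'I_d -> nat) (i0 : 'I_d) (x : position w) :
  nat := x [arg min_(i < i0) x i].

Definition start (d : nat) (w : 'I_d -> nat) (i0 : 'I_d) (x : position w) :
    position w :=
  [ffun i => Ordinal (leq_ltn_trans (leq_subr (depth i0 x) (x i))
                                    (ltn_ord (x i)))].

Lemma depth_le (d : nat) (w : 'I_d -> nat) (i0 : 'I_d) (x : position w) i :
  depth i0 x <= x i.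
Proof. by rewrite /depth; case: arg_minnP => // j _; apply. Qed.

Lemma start_addn (d : nat) (w : 'I_d -> nat) (i0 : 'I_d) (x : position w) i :
  start i0 x i + depth i0 x = x i.
Proof. by rewrite ffunE /= subnK // depth_le. Qed.

Lemma start_in_starts (d : nat) (w : 'I_d -> nat) (i0 : 'I_d)
  (x : position w) : start i0 x \in starts w.
Proof.
by rewrite inE; apply/existsP; exists [arg min_(i < i0) x i]; rewrite ffunE /= subnn.
Qed.

Lemma start_translate (d : nat) (w : 'I_d -> nat) (i0 : 'I_d)
    (x z : position w) (t : nat) :
  z \in starts w -> (forall i, x i = z i + t :> nat) -> start i0 x = z.
Proof.
rewrite inE => /existsP[j /eqP zj0] xE.
(* The zero coordinate [j] of [z] becomes [t] in [x], and no coordinate of [x] is smaller. *)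
have depthE : depth i0 x = t.
  apply/eqP; rewrite eqn_leq; apply/andP; split.
    by have := depth_le i0 x j; rewrite xE zj0.
  by rewrite /depth xE leq_addl.
by apply/ffunP => i; apply: val_inj; rewrite ffunE /= depthE xE addnK.
Qed.

Lemma avoids2_antichain (d : nat) (w : 'I_d -> nat) (M : binmx w) : 0 < d ->
  avoids2_id M ->
  forall x y : position w, M x -> M y -> ~ forall i, x i < y i.
Proof.
by move=> d_gt0 /(contains2_idP _ d_gt0) avM x y Mx My xy; apply: avM; exists x, y.
Qed.

(** On one diagonal, the point of smaller depth is strictly below the other in every coordinate. *)
Lemma start_inj_avoids (d : nat) (w : 'I_d -> nat) (M : binmx w) (i0 : 'I_d) :
  avoids2_id M ->
  {in one_entries M &, injective (start i0)}.
Proof.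
have d_gt0 := leq_ltn_trans (leq0n i0) (ltn_ord i0).
move=> /(avoids2_antichain d_gt0) avM x y; rewrite !inE => Mx My eq_start.
have le_depth u v : M u -> M v -> start i0 u = start i0 v ->
    depth i0 v <= depth i0 u.
  move=> Mu Mv eq_uv; rewrite leqNgt; apply/negP => lt_uv.
  apply: (avM u v Mu Mv) => i.
  by rewrite -(start_addn i0 u) -(start_addn i0 v) eq_uv ltn_add2l.
have eq_depth : depth i0 x = depth i0 y.
  by apply/eqP; rewrite eqn_leq !le_depth.
apply/ffunP => i; apply: val_inj => /=.
by rewrite -(start_addn i0 x) -(start_addn i0 y) eq_start eq_depth.
Qed.

(** The comparable pair created by setting [x] to one must involve [x], as [M] has none, and cannot
    be [x] twice, as the order is strict. *)
Lemma maximal_comparable (d : nat) (w : 'I_d -> nat) (M : binmx w)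
    (x : position w) : 0 < d ->
  maximal_avoids2_id M -> M x = false ->
  exists2 a : position w, M a &
    (forall i, a i < x i) \/ (forall i, x i < a i).
Proof.
move=> d_gt0 [/(avoids2_antichain d_gt0) avM maxM] /maxM /(contains2_idP _ d_gt0)[u [v []]].
rewrite !ffunE; have [-> _ | _ /= Mu] := eqVneq u x; last first.
  by have [-> _ | _ /= Mv] := eqVneq v x; [exists u; auto | case/avM].
have [-> _ xx | _ /= Mv xv] := eqVneq v x; last by exists v; auto.
by have := xx (Ordinal d_gt0); rewrite ltnn.
Qed.

Lemma maximal_meets_diagonal (d : nat) (w : 'I_d -> nat) (M : binmx w) (i0 : 'I_d)
    (z : position w) :
  maximal_avoids2_id M -> z \in starts w ->
  exists2 x, x \in one_entries M & start i0 x = z.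
Proof.
move=> maxM z_start.
have d_gt0 := leq_ltn_trans (leq0n i0) (ltn_ord i0).
have [/(avoids2_antichain d_gt0) avM _] := maxM.
have [/existsP[x /andP[Mx /eqP <-]]|] :=
  boolP [exists x, (x \in one_entries M) && (start i0 x == z)].
  by exists x.
rewrite negb_exists => /forallP missed; exfalso.
have climb t : exists2 x : position w, forall i, x i = z i + t :> nat &
    forall a : position w, M a -> ~ forall i, a i < x i.
  elim: t => [|t [x xE x_min]].
    exists z => [i|a _ az]; first by rewrite addn0.
    move: z_start; rewrite inE => /existsP[j /eqP zj0].
    by have := az j; rewrite zj0.
  have Mx : M x = false.
    by have := missed x; rewrite inE (start_translate _ _ xE) // eqxx andbT => /negbTE.
  have [a Ma [ax|xa]] := maximal_comparable d_gt0 maxM Mx; first by case/x_min: ax.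
  (* The next point [x + (1, ..., 1)] of the diagonal stays in the box because it is bounded by
     [a]. *)
  exists [ffun i => Ordinal (leq_ltn_trans (xa i) (ltn_ord (a i)))].
    by move=> i; rewrite ffunE /= xE addnS.
  move=> b Mb bx; apply: (avM b a Mb Ma) => i.
  by have := bx i; rewrite ffunE /= ltnS => /leq_ltn_trans; apply.
(* After [w i0] steps, coordinate [i0] would be at least [w i0]. *)
have [x xE _] := climb (w i0).
by have := ltn_ord (x i0); rewrite xE ltnNge leq_addl.
Qed.

Theorem theorem1 (d : nat) (w : 'I_d -> nat)
    (hd : 1 <= d) (hw : forall i : 'I_d, 0 < w i) :
  ex2_id w = \prod_(i < d) w i - \prod_(i < d) (w i - 1) /\
  (forall M : binmx w, maximal_avoids2_id M ->
     #|one_entries M| = \prod_(i < d) w i - \prod_(i < d) (w i - 1)).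
Proof.
pose i0 := Ordinal hd; rewrite -card_starts.
have card_le (M : binmx w) : avoids2_id M -> #|one_entries M| <= #|starts w|.
  move=> /(start_inj_avoids (i0 := i0))/card_in_imset <-; apply: subset_leq_card.
  by apply/subsetP => _ /imsetP[x _ ->]; apply: start_in_starts.
split.
  apply/eqP; rewrite eqn_leq; apply/andP; split; first exact/bigmax_leqP.
  apply: leq_trans (leq_bigmax_cond _ (starts_avoid w hd)).
  by apply: subset_leq_card; apply/subsetP => x xS; rewrite !inE ffunE.
move=> M maxM; have [avM _] := maxM.
apply/eqP; rewrite eqn_leq card_le //.
(* By injectivity the ones are as many as the diagonals they meet, which by maximality are all of
   them. *)
rewrite -(card_in_imset (start_inj_avoids (i0 := i0) avM)); apply: subset_leq_card.
apply/subsetP => z /(maximal_meets_diagonal i0 maxM)[x Mx <-].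
exact: imset_f.
Qed.
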